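(* Let $X,Y$ be indecomposable objects of $\mathcal{C}$ that are not in $\mathcal{D}$. Then $\mathrm{Hom}_{\overline{\mathcal{C}}}(X,Y[1])$ is at most one dimensional. It is one dimensional if and only if one of the following conditions is met for the arcs $\ell_X,\ell_Y$ of $X,Y$ in $(S,\overline{M})$: (1) $\ell_X,\ell_Y$ cross; (2) $\ell_X\neq\ell_Y$ share exactly one accumulation point, and one can go from $\ell_X$ to $\ell_Y$ by rotating $\ell_X$ about the common endpoint following the (counter-clockwise) orientation of $S$; (3) $\ell_X=\ell_Y$ have both of their endpoints accumulation points.
   Context: Setting. Let $k$ be an algebraically closed field and $S$ a closed disk whose boundary circle $\partial S$ is oriented counter-clockwise. $M\subset\partial S$ is an infinite set of marked points with set of accumulation points $\mathrm{acc}(M)\subset\partial S$. Assume $M$ is discrete (every $m\in M$ has a neighbourhood meeting $M$ only in $m$), and $\mathrm{acc}(M)=\{z_1,\dots,z_n\}$ is finite with every $z_i$ two-sided (a limit of sequences of pairwise distinct points of $M$ from both sides). Let $S'$ be the disk obtained by replacing each $z_i$ by an ''added'' interval $[z_i^-,z_i^+]$ containing new points $z_{ij}\in(z_i^-,z_i^+)$, $j\in\mathbb{Z}$, increasing counter-clockwise in $j$, with $\lim_{j\to\pm\infty}z_{ij}=z_i^{\pm}$; put $M'=M\cup\{z_{ij}\}$. $M'$ is again discrete with finitely many accumulation points, all two-sided. For $m\in M'$ let $\sigma(m)$ (resp. $\sigma^{-}(m)$) be the next point of $M'$ in clockwise (resp. counter-clockwise) direction. An arc of $(S',M')$ is a pair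 $\{a,b\}$ of distinct non-neighbouring points of $M'$ (pairs of neighbours are boundary segments and are identified with the zero object). Two arcs cross if their four endpoints are distinct and alternate on the circle. The category $\mathcal{C}=\mathcal{C}_{(S',M')}$ is the Igusa–Todorov discrete cluster category of type $\mathbb{A}$: a Hom-finite Krull–Schmidt 2-Calabi–Yau triangulated $k$-category with suspension $[1]$ whose isoclasses of indecomposables $X$ are in bijection with arcs $\ell_X$; if $\ell_X=\{a,b\}$ then $\ell_{X[1]}=\{\sigma(a),\sigma(b)\}$; $\mathrm{Hom}(X,Y[1])$ is $k$ if $\ell_X,\ell_Y$ cross and $0$ otherwise; and for $a_1,a_2,a_3,a_4$ in counter-clockwise order, with $\ell_X=\{a_1,a_3\}$, $\ell_Y=\{a_2,a_4\}$, $\ell_A=\{a_1,a_2\}$, $\ell_B=\{a_2,a_3\}$, $\ell_C=\{a_3,a_4\}$, $\ell_D=\{a_4,a_1\}$, there are non-split exact triangles $X\to B\oplus D\to Y\to X[1]$ and $Y\to A\oplus C\to X\to Y[1]$. Let $\mathcal{D}\subset\mathcal{C}$ be the full additive subcategory generated by indecomposables whose arcs have both endpoints in one interval $(z_i^-,z_i^+)$ (a thick subcategory), $\Sigma$ the class of morphisms of $\mathcal{C}$ with cone in $\mathcal{D}$, and $\overline{\mathcal{C}}=\overline{\mathcal{C}}_{(S,M)}=\mathcal{C}[\Sigma^{-1}]$ the Verdier quotient (same objects as $\mathcal{C}$). Put $\overline{M}=M\cup\mathrm{acc}(M)$. An arc of $(S,\overline{M})$ is a pair of distinct points of $\overline{M}$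 that is not a pair of neighbouring points of $M$. An indecomposable $X$ of $\mathcal{C}$ not in $\mathcal{D}$ has an arc $\ell_X$ in $(S,\overline{M})$, obtained by contracting each interval $[z_i^-,z_i^+]$ to $z_i$. Rotating $\{z,m\}$ about $z$ following the orientation means that the other endpoint $m$ moves counter-clockwise along $\partial S$ without passing $z$; so in (2), with $\ell_X=\{z,m\}$, $\ell_Y=\{z,n\}$, the points $z,m,n$ are in counter-clockwise cyclic order. *)

(* Defs.v *)
From HB Require Import structures.
From mathcomp Require Import all_boot all_order all_algebra.
From mathcomp Require Import all_classical all_reals.
From mathcomp Require Import topology normedtype.

Set Implicit Arguments.
Unset Strict Implicit.
Unset Printing Implicit Defensive.

Import Order.TTheory GRing.Theory Num.Theory.
Import numFieldNormedType.Exports.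

Local Open Scope classical_set_scope.
Local Open Scope ring_scope.

Section Disk.
Variable R : realType.
Implicit Types (p q r z : R * R) (M : set (R * R)).

(* The closed disk is normalised to the unit disk of the plane. *)
Definition circle : set (R * R) := [set p | p.1 ^+ 2 + p.2 ^+ 2 = 1].

(* Sign of the area of the triangle pqr: three points of the circle satisfy
   this iff they are distinct and met in the order p, q, r, p when running
   through the circle counter-clockwise. *)
Definition ccw p q r : Prop :=
  0 < (q.1 - p.1) * (r.2 - p.2) - (q.2 - p.2) * (r.1 - p.1).

Definition acc M : set (R * R) := limit_point M.

(* The two sides of z are the two open half-circles bounded by z and - z. *)
Definition two_sided M z : Prop :=
  (exists u : nat -> R * R, [/\ injective u, (forall n, M (u n)),
     (forall n, ccw z (u n) (- z)) & u n @[n --> \oo] --> z]) /\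
  (exists u : nat -> R * R, [/\ injective u, (forall n, M (u n)),
     (forall n, ccw (- z) (u n) z) & u n @[n --> \oo] --> z]).

Definition marked_set M : Prop :=
  [/\ M `<=` circle, infinite_set M, M `<=` isolated M,
      finite_set (acc M) & acc M `<=` two_sided M].

(* The set M': the points of M together with points z_j, j in Z, for every
   accumulation point z.  Only the cyclic order of M' on the boundary of S'
   matters, so S' itself is not built. *)
Inductive marked (M : set (R * R)) : Type :=
  | Old of M
  | New of acc M & int.

HB.instance Definition _ M := gen_eqMixin (marked M).
HB.instance Definition _ M := gen_choiceMixin (marked M).

Definition contract M (a : marked M) : R * R :=
  match a with Old m => val m | New z _ => val z end.

(* a and b lie in the same added interval, a being nearer to its initial
   endpoint z^-. *)
Definition before M (a b : marked M) : Prop :=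
  exists (z : acc M) (i j : int),
    [/\ a = New z i, b = New z j & i < j].

(* The order of M' on the boundary of S' is the order on the boundary of S
   refined by the order of each added interval. *)
Definition mccw M (a b c : marked M) : Prop :=
  [\/ ccw (contract a) (contract b) (contract c),
      (before a b /\ contract c <> contract a) \/
      (before b c /\ contract a <> contract b) \/
      (before c a /\ contract b <> contract c)
    | (before a b /\ before b c) \/ (before b c /\ before c a) \/
      (before c a /\ before a b)].

Definition next_cw M (a b : marked M) : Prop :=
  b <> a /\ forall c, ~ mccw b c a.

(* The clockwise neighbour; it always exists when marked_set M holds. *)
Definition sigma M (a : marked M) : marked M := xget a [set b | next_cw a b].

Definition neighbours M (a b : marked M) : Prop := next_cw a b \/ next_cw b a.

Definition is_arc M (s : set (marked M)) : Prop :=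
  exists a b, [/\ s = [set a; b], a <> b & ~ neighbours a b].

End Disk.

(* The pairs s and t alternate for the cyclic order cyc, which is empty on
   triples that are not pairwise distinct. *)
Definition crossing (T : Type) (cyc : T -> T -> T -> Prop) (s t : set T) : Prop :=
  exists a b c d, [/\ s = [set a; b], t = [set c; d], cyc a c b & cyc b d a].

Record category := Category {
  cobj : Type;
  chom : cobj -> cobj -> Type;
  cidm : forall X, chom X X;
  ccomp : forall X Y Z, chom Y Z -> chom X Y -> chom X Z;
  ccomp1l : forall X Y (f : chom X Y), ccomp (cidm Y) f = f;
  ccomp1r : forall X Y (f : chom X Y), ccomp f (cidm X) = f;
  ccompA : forall X Y Z W (f : chom X Y) (g : chom Y Z) (h : chom Z W),
    ccomp h (ccomp g f) = ccomp (ccomp h g) f }.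

Definition is_iso (E : category) (X Y : cobj E) (f : chom X Y) : Prop :=
  exists g : chom Y X, ccomp g f = cidm X /\ ccomp f g = cidm Y.

Record functor (E F : category) := Functor {
  fobj : cobj E -> cobj F;
  fmor : forall X Y, chom X Y -> chom (fobj X) (fobj Y);
  fmor1 : forall X, fmor (cidm X) = cidm (fobj X);
  fmorM : forall X Y Z (f : chom X Y) (g : chom Y Z),
    fmor (ccomp g f) = ccomp (fmor g) (fmor f) }.

(* A k-linear category with a prescribed class of objects. *)
Record lincat (k : fieldType) (ob : Type) := LinCat {
  mor : ob -> ob -> lmodType k;
  idh : forall X, mor X X;
  comph : forall X Y Z, mor Y Z -> mor X Y -> mor X Z;
  comp1l : forall X Y (f : mor X Y), comph (idh Y) f = f;
  comp1r : forall X Y (f : mor X Y), comph f (idh X) = f;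
  compA : forall X Y Z W (f : mor X Y) (g : mor Y Z) (h : mor Z W),
    comph h (comph g f) = comph (comph h g) f;
  comp_linl : forall X Y Z (f : mor X Y),
    linear (fun g : mor Y Z => comph g f);
  comp_linr : forall X Y Z (g : mor Y Z),
    linear (fun f : mor X Y => comph g f) }.

Arguments idh {k ob l} X.
Notation "g \oc f" := (comph g f) (at level 40, left associativity).

Definition cat_of (k : fieldType) (ob : Type) (C : lincat k ob) : category :=
  @Category ob (fun X Y => mor C X Y : Type) (fun X => @idh _ _ C X)
    (fun X Y Z => @comph _ _ C X Y Z) (@comp1l _ _ C) (@comp1r _ _ C)
    (@compA _ _ C).

Definition has_dim (k : fieldType) (n : nat) (V : lmodType k) : Prop :=
  inhabited (Vector.axiom n V).

Section LinearCategory.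
Variables (k : fieldType) (ob : Type) (C : lincat k ob).
Implicit Types X Y Z : ob.

Definition isoh X Y (f : mor C X Y) : Prop := is_iso (E := cat_of C) f.

Definition isomorphic X Y : Prop := exists f : mor C X Y, isoh f.

Definition is_zero X : Prop := @idh _ _ C X = 0.

(* S is a direct sum of the finite family F. *)
Definition is_dsum (I : finType) (F : I -> ob) (S : ob) : Prop :=
  exists (inj : forall i, mor C (F i) S) (pr : forall i, mor C S (F i)),
    [/\ forall i, pr i \oc inj i = idh (F i),
        forall i j, i != j -> pr j \oc inj i = 0
      & \sum_i inj i \oc pr i = idh S].

Definition is_dsum2 X Y S : Prop :=
  is_dsum (fun b : bool => if b then X else Y) S.

Definition additive_cat : Prop :=
  forall (n : nat) (F : 'I_n -> ob), exists S, is_dsum F S.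

Definition indec X : Prop :=
  ~ is_zero X /\ forall A B, is_dsum2 A B X -> is_zero A \/ is_zero B.

Definition local_end X : Prop :=
  ~ is_zero X /\ forall f : mor C X X, isoh f \/ isoh (idh X - f).

Definition krull_schmidt : Prop :=
  forall X, exists (n : nat) (F : 'I_n -> ob),
    (forall i, local_end (F i)) /\ is_dsum F X.

Definition hom_finite : Prop := forall X Y, exists n, has_dim n (mor C X Y).

End LinearCategory.

Record tricat (k : fieldType) := TriCat {
  tob : Type;
  tlin :> lincat k tob;
  (* the suspension, a k-linear autoequivalence *)
  susp : tob -> tob;
  shm : forall X Y, {linear mor tlin X Y -> mor tlin (susp X) (susp Y)};
  shm1 : forall X, shm X X (idh X) = idh (susp X);
  shmM : forall X Y Z (f : mor tlin X Y) (g : mor tlin Y Z),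
    shm X Z (g \oc f) = shm Y Z g \oc shm X Y f;
  sh_ff : forall X Y, bijective (shm X Y);
  sh_es : forall Y, exists X, isomorphic tlin (susp X) Y;
  tadd : additive_cat tlin;
  (* the distinguished (exact) triangles *)
  dist : forall X Y Z,
    mor tlin X Y -> mor tlin Y Z -> mor tlin Z (susp X) -> Prop;
  dist_iso : forall X Y Z X' Y' Z'
      (f : mor tlin X Y) (g : mor tlin Y Z) (h : mor tlin Z (susp X))
      (f' : mor tlin X' Y') (g' : mor tlin Y' Z') (h' : mor tlin Z' (susp X'))
      (a : mor tlin X X') (b : mor tlin Y Y') (c : mor tlin Z Z'),
    isoh a -> isoh b -> isoh c ->
    b \oc f = f' \oc a -> c \oc g = g' \oc b -> shm X X' a \oc h = h' \oc c ->
    dist f g h -> dist f' g' h';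
  dist_id : forall X Z, is_zero tlin Z ->
    dist (idh X) (0 : mor tlin X Z) (0 : mor tlin Z (susp X));
  dist_cone : forall X Y (f : mor tlin X Y), exists Z
      (g : mor tlin Y Z) (h : mor tlin Z (susp X)), dist f g h;
  dist_rot : forall X Y Z
      (f : mor tlin X Y) (g : mor tlin Y Z) (h : mor tlin Z (susp X)),
    dist f g h <-> dist g h (- shm X Y f);
  dist_mor : forall X Y Z X' Y' Z'
      (f : mor tlin X Y) (g : mor tlin Y Z) (h : mor tlin Z (susp X))
      (f' : mor tlin X' Y') (g' : mor tlin Y' Z') (h' : mor tlin Z' (susp X'))
      (a : mor tlin X X') (b : mor tlin Y Y'),
    dist f g h -> dist f' g' h' -> b \oc f = f' \oc a ->
    exists c : mor tlin Z Z', c \oc g = g' \oc b /\ shm X X' a \oc h = h' \oc c;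
  (* octahedral axiom *)
  dist_oct : forall X Y Z X' Y' Z' (f : mor tlin X Y) (g : mor tlin Y Z)
      (f1 : mor tlin Y Z') (f2 : mor tlin Z' (susp X))
      (g1 : mor tlin Z X') (g2 : mor tlin X' (susp Y))
      (h1 : mor tlin Z Y') (h2 : mor tlin Y' (susp X)),
    dist f f1 f2 -> dist g g1 g2 -> dist (g \oc f) h1 h2 ->
    exists (u : mor tlin Z' Y') (v : mor tlin Y' X'),
      dist u v (shm Y Z' f1 \oc g2) /\
      [/\ u \oc f1 = h1 \oc g, v \oc h1 = g1,
          h2 \oc u = f2 & g2 \oc v = shm X Y f \oc h2] }.

(* A bifunctorial linear bijection from Hom(X, Y) to the dual of
   Hom(Y, X[2]), given as a family of bilinear pairings. *)
Definition calabi_yau2 (k : fieldType) (C : tricat k) : Prop :=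
  exists phi : forall X Y, mor C X Y -> mor C Y (susp (susp X)) -> k,
  [/\ forall X Y (g : mor C Y (susp (susp X))),
        linear (fun f : mor C X Y => phi X Y f g : k^o),
      forall X Y (f : mor C X Y), linear (phi X Y f : _ -> k^o),
      forall X Y (lam : {linear mor C Y (susp (susp X)) -> k^o}),
        exists! f : mor C X Y, forall g, phi X Y f g = lam g
    & forall X X' Y Y' (u : mor C X' X) (f : mor C X Y) (v : mor C Y Y')
        (g : mor C Y' (susp (susp X'))),
        phi X' Y' (v \oc f \oc u) g =
        phi X Y f (shm (susp X') (susp X) (shm X' X u) \oc g \oc v)].

Section ClusterCategory.
Variables (R : realType) (M : set (R * R)).
Variables (k : fieldType) (C : tricat k) (ell : tob C -> set (marked M)).
Implicit Types X Y : tob C.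

(* X is the object attached to the pair {a, b}, which is zero if a and b are
   neighbours. *)
Definition represents X (a b : marked M) : Prop :=
  (indec C X /\ ell X = [set a; b]) \/ (is_zero C X /\ neighbours a b).

(* C, with the arc ell X attached to each indecomposable X, is the
   Igusa-Todorov category of (S', M').  In the exchange triangles, exchanging
   the roles of X and Y is the same as renaming a1, a2, a3, a4 to
   a2, a3, a4, a1.  A triangle is non-split iff its third map is nonzero. *)
Record cluster_category : Prop := ClusterCategory {
  cl_fin : hom_finite C;
  cl_ks : krull_schmidt C;
  cl_cy : calabi_yau2 C;
  cl_arc : forall X, indec C X -> is_arc (ell X);
  cl_surj : forall s, is_arc s -> exists X, indec C X /\ ell X = s;
  cl_inj : forall X Y, indec C X -> indec C Y ->
    (ell X = ell Y <-> isomorphic C X Y);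
  cl_sh : forall X, indec C X -> ell (susp X) = @sigma R M @` ell X;
  cl_cross : forall X Y, indec C X -> indec C Y ->
    crossing (@mccw R M) (ell X) (ell Y) -> has_dim 1%N (mor C X (susp Y));
  cl_ncross : forall X Y, indec C X -> indec C Y ->
    ~ crossing (@mccw R M) (ell X) (ell Y) -> has_dim 0%N (mor C X (susp Y));
  cl_exch : forall (a1 a2 a3 a4 : marked M) X Y A12 A23 A34 A41,
    mccw a1 a2 a3 -> mccw a1 a3 a4 ->
    indec C X -> ell X = [set a1; a3] -> indec C Y -> ell Y = [set a2; a4] ->
    represents A12 a1 a2 -> represents A23 a2 a3 ->
    represents A34 a3 a4 -> represents A41 a4 a1 ->
    (exists S (f : mor C X S) (g : mor C S Y) (h : mor C Y (susp X)),
      [/\ is_dsum2 C A23 A41 S, dist f g h & h <> 0]) /\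
    (exists S (f : mor C Y S) (g : mor C S X) (h : mor C X (susp Y)),
      [/\ is_dsum2 C A12 A34 S, dist f g h & h <> 0]) }.

Definition in_interval X : Prop := exists z : acc M, ell X `<=` range (New z).

Definition inD X : Prop :=
  exists (n : nat) (F : 'I_n -> tob C),
    (forall i, indec C (F i) /\ in_interval (F i)) /\ is_dsum C F X.

Definition Sigma X Y (s : mor C X Y) : Prop :=
  exists Z (g : mor C Y Z) (h : mor C Z (susp X)), dist s g h /\ inD Z.

(* The arc of X in (S, M \cup acc M), for X indecomposable not in D. *)
Definition ellbar X : set (R * R) := @contract R M @` ell X.

End ClusterCategory.

(* The k-linear functor Q, which is the identity on objects, exhibits L as the
   localisation C[W^-1]: it inverts W and is universal (up to equality, not
   only up to isomorphism) among all functors that do so. *)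
Record localisation (k : fieldType) (ob : Type) (C L : lincat k ob)
    (W : forall X Y, mor C X Y -> Prop)
    (Q : forall X Y, {linear mor C X Y -> mor L X Y}) : Prop := Localisation {
  loc1 : forall X, Q X X (idh X) = idh X;
  locM : forall X Y Z (f : mor C X Y) (g : mor C Y Z),
    Q X Z (g \oc f) = Q Y Z g \oc Q X Y f;
  locW : forall X Y (s : mor C X Y), W X Y s -> isoh (Q X Y s);
  locU : forall (E : category) (F : functor (cat_of C) E),
    (forall X Y (s : mor C X Y), W X Y s -> is_iso (fmor F s)) ->
    exists! G : forall X Y, mor L X Y -> chom (fobj F X) (fobj F Y),
      [/\ forall X, G X X (idh X) = cidm (fobj F X),
          forall X Y Z (f : mor L X Y) (g : mor L Y Z),
            G X Z (g \oc f) = ccomp (G Y Z g) (G X Y f)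
        & forall X Y (f : mor C X Y), G X Y (Q X Y f) = fmor F f] }.

(* Main.v *)
Require Import Defs.
From mathcomp Require Import all_boot all_order all_algebra.
From mathcomp Require Import all_classical all_reals.
From mathcomp Require Import topology normedtype.
From mathcomp Require Import zify lra.
Import Order.TTheory GRing.Theory Num.Theory.
Local Open Scope classical_set_scope.
Local Open Scope ring_scope.

(** Let X be an arc outside D and let X_n be the arc obtained by moving the ends
    of X that lie in added intervals n steps clockwise inside these intervals.

    The X_n form a system that computes morphisms of the quotient out of X.
    Exchanging the arcs {b, New z (i - n)} and {New z (i - n - 1), New z i}
    gives a triangle X_n -> X -> W -> X_n[1] in which W lies in D, so all X_n
    are isomorphic to X in the quotient ([rotate_end], [rotate_ends]).  An arc
    U inside one added interval is eventually passed by the ends of X_n, hence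
    not crossed by X_n, and as D is stable under desuspension both Hom(X_n, U)
    and Hom(X_n[1], U) vanish for large n.  The long exact sequence of a
    triangle then shows that each s in Sigma induces a bijection on
    Hom(X_n, -) for large n ([tower_W_bij]).

    It follows that Hom(X, Z) in the quotient is the colimit of Hom(X_n, Z).
    Both halves come from the universal property of the localisation rather
    than from a calculus of fractions.  The morphisms p such that every
    composite p \oc Q f, with f starting at a far enough X_n, comes from C are
    closed under composition, and contain the image of Q and the inverses of
    Sigma, so they are all morphisms ([localisation_lift]).  Conversely, sending
    Z to the product of the Hom(X_n, Z) modulo eventual equality inverts Sigma;
    so a morphism f of C killed by Q acts on this product as 0 does, which means
    that its composites with maps from X_n are eventually 0
    ([localisation_kernel]).

    Now rotate X until its ends precede those of Y in every interval that they
    share.  Then the cones W do not cross Y, so that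
    Hom(X, Y[1]) -> Hom(X_n, Y[1]) is injective and Hom(X, Y[1]) is the same in
    the quotient as in C ([hom_far]): one-dimensional if X and Y cross in M',
    and 0 otherwise.  In this position a common accumulation point supplies one
    of the two alternations needed for a crossing, because the end of X precedes
    that of Y there.  If there is exactly one such point, the other alternation
    says that Y is obtained from X by a counter-clockwise rotation; if there are
    two, X and Y always cross.  This is the list of the three conditions
    ([crossing_far]). *)

(** * Linear categories *)

Section LinearCategories.
Set Implicit Arguments.
Unset Strict Implicit.
Variables (k : fieldType) (ob : Type) (C : lincat k ob).
Implicit Types X Y Z W : ob.

Lemma compDr X Y Z (g : mor C Y Z) (f f' : mor C X Y) :
  g \oc (f + f') = g \oc f + g \oc f'.
Proof. by have := comp_linr g 1 f f'; rewrite /= !scale1r. Qed.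

Lemma compDl X Y Z (f : mor C X Y) (g g' : mor C Y Z) :
  (g + g') \oc f = g \oc f + g' \oc f.
Proof. by have := comp_linl f 1 g g'; rewrite /= !scale1r. Qed.

Lemma comp0r X Y Z (g : mor C Y Z) : g \oc (0 : mor C X Y) = 0.
Proof.
by apply: (addrI (g \oc (0 : mor C X Y))); rewrite -compDr !addr0.
Qed.

Lemma comp0l X Y Z (f : mor C X Y) : (0 : mor C Y Z) \oc f = 0.
Proof.
by apply: (addrI ((0 : mor C Y Z) \oc f)); rewrite -compDl !addr0.
Qed.

Lemma compZl X Y Z (f : mor C X Y) (g : mor C Y Z) (c : k) :
  (c *: g) \oc f = c *: (g \oc f).
Proof. by have := comp_linl f c g 0; rewrite /= comp0l !addr0. Qed.

Lemma compZr X Y Z (g : mor C Y Z) (f : mor C X Y) (c : k) :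
  g \oc (c *: f) = c *: (g \oc f).
Proof. by have := comp_linr g c f 0; rewrite /= comp0r !addr0. Qed.

Lemma compNr X Y Z (g : mor C Y Z) (f : mor C X Y) : g \oc (- f) = - (g \oc f).
Proof. by rewrite -scaleN1r compZr scaleN1r. Qed.

Lemma compNl X Y Z (f : mor C X Y) (g : mor C Y Z) : (- g) \oc f = - (g \oc f).
Proof. by rewrite -scaleN1r compZl scaleN1r. Qed.

Lemma comp_suml X Y Z (I : finType) (f : mor C X Y) (g : I -> mor C Y Z) :
  (\sum_i g i) \oc f = \sum_i (g i \oc f).
Proof.
by apply: (big_morph (fun g => g \oc f) (compDl f)); rewrite comp0l.
Qed.

Lemma zero_mor_from X Y (f : mor C X Y) : is_zero C X -> f = 0.
Proof. by move=> X0; rewrite -(comp1r f) X0 comp0r. Qed.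

Lemma isoh_id X : isoh (idh X : mor C X X).
Proof. by exists (idh X); split; rewrite /= comp1l. Qed.

Lemma isoh_comp X Y Z (f : mor C X Y) (g : mor C Y Z) :
  isoh f -> isoh g -> isoh (g \oc f).
Proof.
move=> [f' [/= f'f ff']] [g' [/= g'g gg']]; exists (f' \oc g'); split => /=.
  by rewrite Defs.compA -(Defs.compA g g' f') g'g comp1r.
by rewrite Defs.compA -(Defs.compA f' f g) ff' comp1r.
Qed.

Lemma isoh_inj_pre X Y Z (s : mor C X Y) (f g : mor C Y Z) :
  isoh s -> f \oc s = g \oc s -> f = g.
Proof.
move=> [s' [_ /= ss']] fg.
by rewrite -(comp1r f) -(comp1r g) -ss' !Defs.compA fg.
Qed.

Lemma isomorphic_sym X Y : isomorphic C X Y -> isomorphic C Y X.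
Proof.
by move=> [f [g [/= gf fg]]]; exists g, f; split.
Qed.

Lemma is_zero_iso X Y : isomorphic C X Y -> is_zero C X -> is_zero C Y.
Proof.
move=> [f [g [/= gf fg]]] X0.
by rewrite /is_zero -fg (zero_mor_from f X0) comp0l.
Qed.

Lemma is_dsum_iso (I : finType) (F : I -> ob) X Y :
  isomorphic C X Y -> is_dsum C F X -> is_dsum C F Y.
Proof.
move=> [f [g [/= gf fg]]] [inj [pr [pi pij s1]]].
exists (fun i => f \oc inj i), (fun i => pr i \oc g); split.
- by move=> i; rewrite Defs.compA -(Defs.compA f g) gf comp1r pi.
- by move=> i j ij; rewrite Defs.compA -(Defs.compA f g) gf comp1r pij.
- transitivity (f \oc (\sum_i inj i \oc pr i) \oc g); last first.
    by rewrite s1 comp1r fg.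
  rewrite (big_morph (fun u => f \oc u) (compDr f) (comp0r _ f)).
  by rewrite comp_suml; apply: eq_bigr => i _; rewrite !Defs.compA.
Qed.

Lemma indec_iso X Y : isomorphic C X Y -> indec C X -> indec C Y.
Proof.
move=> XY [X0 indX]; split.
  by move=> Y0; apply: X0; apply: is_zero_iso Y0; apply: isomorphic_sym.
by move=> A B sAB; apply: indX; apply: is_dsum_iso sAB; apply: isomorphic_sym.
Qed.

Lemma is_dsum1 X : is_dsum C (fun _ : 'I_1 => X) X.
Proof.
exists (fun=> idh X), (fun=> idh X); split.
- by move=> i; rewrite comp1l.
- by move=> i j; rewrite !ord1.
- by rewrite big_ord1 comp1l.
Qed.

Lemma dsum2_zerol X Y S : is_dsum2 C X Y S -> is_zero C X ->
  exists p : mor C S Y, isoh p.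
Proof.
move=> [inj [pr [pi pij s1]]] X0; exists (pr false), (inj false); split => /=.
  rewrite -s1 big_bool /= addrC -[LHS]addr0; congr (_ + _).
  by rewrite (zero_mor_from (inj true) X0) comp0l.
exact: (pi false).
Qed.

Lemma has_dim0P (V : lmodType k) : has_dim 0%N V <-> forall v : V, v = 0.
Proof.
split=> [[[r rlin [s rs sr]]] v|V0].
  by rewrite -(rs v) -(rs 0) (thinmx0 (r v)) (thinmx0 (r 0)).
constructor; exists (fun=> 0); first by move=> a u v; rewrite scaler0 addr0.
by exists (fun=> 0) => // v; rewrite ?(thinmx0 v) // [RHS]V0.
Qed.

Lemma has_dim1P (V : lmodType k) :
  has_dim 1%N V <-> exists2 v : V, v != 0 & forall w, exists c : k, w = c *: v.
Proof.
split=> [[[r rlin [s rs sr]]]|[v v0 vV]].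
  have r0 : r 0 = 0.
    by have := rlin (-1) 0 0; rewrite scaleN1r oppr0 addr0 scaleN1r addNr.
  have rZ c u : r (c *: u) = c *: r u.
    by have := rlin c u 0; rewrite r0 !addr0.
  exists (s (const_mx 1)) => [|w].
    apply/eqP => /(congr1 r); rewrite sr r0 => /matrixP/(_ 0 0).
    by rewrite !mxE => /eqP; rewrite oner_eq0.
  exists (r w 0 0); apply: (can_inj rs); rewrite rZ sr.
  by apply/matrixP=> i j; rewrite !ord1 !mxE mulr1.
have cI (c d : k) : c *: v = d *: v -> c = d.
  move=> cd; apply/eqP; rewrite -subr_eq0.
  have : (c - d) *: v == 0 by rewrite scalerBl cd subrr.
  by rewrite scaler_eq0 (negPf v0) orbF.
have [r rP] := choice vV.
constructor; exists (fun w => (r w)%:M) => [a u w|].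
  rewrite scale_scalar_mx -raddfD; congr (_%:M); apply: cI.
  by rewrite -rP scalerDl -scalerA -!rP.
exists (fun A : 'rV_1 => A 0 0 *: v) => [w|A]; first by rewrite mxE -rP.
by rewrite [RHS]mx11_scalar; congr (_%:M); apply: cI; rewrite -rP.
Qed.
End LinearCategories.

(** * Localisations and eventually local systems *)

Section Localisation.
Set Implicit Arguments.
Unset Strict Implicit.
Variables (k : fieldType) (ob : Type) (C L : lincat k ob).
Variables (W : forall X Y, mor C X Y -> Prop).
Variables (Q : forall X Y, {linear mor C X Y -> mor L X Y}).
Hypothesis hQ : localisation W Q.

Lemma sval_inj (T : Type) (P : T -> Prop) (x y : {z | P z}) :
  sval x = sval y -> x = y.
Proof. by case: x y => [x px] [y py] /= xy; exact: eq_exist. Qed.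

Lemma Q_isoh X Y (f : mor C X Y) : isoh f -> isoh (Q X Y f).
Proof.
move=> [g [/= gf fg]]; exists (Q Y X g) => /=.
by split; rewrite -(locM hQ) ?gf ?fg (loc1 hQ).
Qed.

(** The morphisms with such a property P form a subcategory E through which Q
    factors.  Universality gives a functor from L to E, and its composite with
    the inclusion of E must be the identity of L, as both extend Q. *)
Lemma localisation_ind (P : forall X Y, mor L X Y -> Prop) :
  (forall X, P X X (idh X)) ->
  (forall X Y Z (f : mor L X Y) (g : mor L Y Z),
     P _ _ f -> P _ _ g -> P _ _ (g \oc f)) ->
  (forall X Y (f : mor C X Y), P _ _ (Q X Y f)) ->
  (forall X Y (s : mor C X Y) (t : mor L Y X), W s ->
     t \oc Q X Y s = idh X -> Q X Y s \oc t = idh Y -> P _ _ t) ->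
  forall X Y (f : mor L X Y), P _ _ f.
Proof.
move=> P1 PM PQ PV X Y f.
pose hom X Y := {f : mor L X Y | P X Y f}.
pose id1 X : hom X X := exist _ (idh X) (P1 X).
pose comp X Y Z (g : hom Y Z) (f : hom X Y) : hom X Z :=
  exist _ (sval g \oc sval f) (PM _ _ _ _ _ (svalP f) (svalP g)).
have id1l X0 Y0 (u : hom X0 Y0) : comp _ _ _ (id1 Y0) u = u.
  by apply: sval_inj; exact: comp1l.
have id1r X0 Y0 (u : hom X0 Y0) : comp _ _ _ u (id1 X0) = u.
  by apply: sval_inj; exact: comp1r.
have hcompA X0 Y0 Z0 V0 (u : hom X0 Y0) (v : hom Y0 Z0) (w : hom Z0 V0) :
    comp _ _ _ w (comp _ _ _ v u) = comp _ _ _ (comp _ _ _ w v) u.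
  by apply: sval_inj; exact: Defs.compA.
pose E := @Category ob hom id1 comp id1l id1r hcompA.
have F1 X0 : exist _ (Q X0 X0 (idh X0)) (PQ _ _ _) = cidm (X0 : cobj E).
  by apply: sval_inj => /=; rewrite (loc1 hQ).
have FM X0 Y0 Z0 (u : mor C X0 Y0) (v : mor C Y0 Z0) :
    exist _ (Q X0 Z0 (v \oc u)) (PQ _ _ _) =
    @ccomp E X0 Y0 Z0 (exist _ (Q Y0 Z0 v) (PQ _ _ _))
                      (exist _ (Q X0 Y0 u) (PQ _ _ _)).
  by apply: sval_inj => /=; rewrite (locM hQ).
pose F : functor (cat_of C) E := @Functor (cat_of C) E id
  (fun X Y f => exist _ (Q X Y f) (PQ X Y f)) F1 FM.
have [|G [[G1 GM GQ] _]] := locU hQ (F := F).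
  move=> X0 Y0 s sW; have [t [/= ts st]] := locW hQ sW.
  exists (exist _ t (PV _ _ s t sW ts st)).
  by split; apply: sval_inj.
pose FQ : functor (cat_of C) (cat_of L) := @Functor (cat_of C) (cat_of L) id
  (fun X Y f => Q X Y f) (loc1 hQ) (fun X Y Z f g => locM hQ f g).
have [|H [_ Huniq]] := locU hQ (F := FQ); first by move=> X0 Y0 s; exact: locW.
have HG : H = (fun X Y f => sval (G X Y f)).
  apply: Huniq; split => [X0|X0 Y0 Z0 u v|X0 Y0 u].
  - by rewrite G1.
  - by rewrite GM.
  - by rewrite GQ.
have Hid : H = (fun X Y f => f) by apply: Huniq; split.
(* So every f is the image of a morphism of E, which carries a proof of P. *)
have -> : f = sval (G X Y f).
  by have := congr1 (fun K => K X Y f) HG; rewrite Hid.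
exact: svalP.
Qed.

Variable Xs : nat -> ob.
Hypothesis W_bij : forall Y Z (s : mor C Y Z), W s -> \forall n \near \oo,
  (forall f g : mor C (Xs n) Y, s \oc f = s \oc g -> f = g) /\
  (forall f : mor C (Xs n) Z, exists g, f = s \oc g).

(** Surjectivity of the map from the colimit of the Hom(Xs n, Z). *)
Lemma localisation_lift Y Z (p : mor L Y Z) : \forall n \near \oo,
  forall f : mor C (Xs n) Y, exists g, p \oc Q _ _ f = Q _ _ g.
Proof.
move: Y Z p; apply: localisation_ind.
- by move=> Y; apply: nearW => n f; exists f; rewrite comp1l.
- move=> Y Z V p q; apply: filterS2 => n pP qP f.
  have [g pg] := pP f; have [h qh] := qP g.
  by exists h; rewrite -Defs.compA pg.
- by move=> Y Z h; apply: nearW => n f; exists (h \oc f); rewrite (locM hQ).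
- move=> Y Z s t sW ts st; apply: filterS (W_bij sW) => n [_ surj] f.
  have [g ->] := surj f; exists g.
  by rewrite (locM hQ) Defs.compA ts comp1l.
Qed.

(** The subsets of the product of the Hom(Xs n, Z) modulo eventual equality.
    Passing to subsets, which turns the product into a contravariant functor,
    replaces the quotient by a saturation condition. *)
Let germset Z : Type :=
  {A : set (forall n, mor C (Xs n) Z) |
   forall f g, (\forall n \near \oo, f n = g n) -> A f -> A g}.

Let pull_subproof Y Z (s : mor C Y Z) (A : germset Z)
  (f g : forall n, mor C (Xs n) Y) : (\forall n \near \oo, f n = g n) ->
  sval A (fun n => s \oc f n) -> sval A (fun n => s \oc g n).
Proof. by move=> fg; apply: (svalP A); apply: filterS fg => n ->. Qed.

Let pull Y Z (s : mor C Y Z) (A : germset Z) : germset Y :=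
  exist _ [set f | sval A (fun n => s \oc f n)] (pull_subproof (s:=s) (A:=A)).

Let push_subproof Y Z (s : mor C Y Z) (A : germset Y) g g' :
  (\forall n \near \oo, g n = g' n) ->
  (exists2 f, sval A f & \forall n \near \oo, s \oc f n = g n) ->
  (exists2 f, sval A f & \forall n \near \oo, s \oc f n = g' n).
Proof.
by move=> gg' [f Af sf]; exists f => //; apply: filterS2 sf gg' => n -> ->.
Qed.

(** Direct images invert [pull s] as soon as s lies in W. *)
Let push Y Z (s : mor C Y Z) (A : germset Y) : germset Z :=
  exist _ [set g | exists2 f, sval A f & \forall n \near \oo, s \oc f n = g n]
    (push_subproof (s:=s) (A:=A)).

(** The functor of germs inverts W, hence factors through Q and cannot tell f
    from 0.  Evaluated on the set of the eventually zero families, this says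
    that T lies in its inverse image under f, since it does so under 0. *)
Lemma localisation_kernel X Z (T : forall n, mor C (Xs n) X)
    (f : mor C X Z) :
  Q X Z f = 0 -> \forall n \near \oo, f \oc T n = 0.
Proof.
move=> Qf0.
pose E : category := @Category ob (fun X Y => germset Y -> germset X)
  (fun X A => A) (fun X Y Z g f A => f (g A)) (fun _ _ _ => erefl)
  (fun _ _ _ => erefl) (fun _ _ _ _ _ _ _ => erefl).
have F1 Y : pull (idh Y) = id.
  apply/funext => A; apply: sval_inj; apply/seteqP; split=> u /=;
  by have -> : (fun n => idh Y \oc u n) = u
     by apply/functional_extensionality_dep => n; exact: comp1l.
have FM Y1 Y2 Y3 (u : mor C Y1 Y2) (v : mor C Y2 Y3) :
    pull (v \oc u) = (fun A => pull u (pull v A)).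
  apply/funext => A; apply: sval_inj; apply/seteqP; split=> w /=;
  by have -> : (fun n => v \oc u \oc w n) = (fun n => v \oc (u \oc w n))
    by apply/functional_extensionality_dep => n; rewrite Defs.compA.
pose F : functor (cat_of C) E := @Functor (cat_of C) E id pull F1 FM.
have [|G [[_ _ GQ] _]] := locU hQ (F := F).
  move=> Y1 Y2 s sW; exists (push s : @chom E Y2 Y1).
  split => /=; apply/funext => A; apply: sval_inj; apply/seteqP; split=> u /=.
  - move=> [f0 Af0 sf0]; apply: (svalP A) Af0.
    by apply: filterS2 sf0 (W_bij sW) => n sfu [inj _]; exact: inj.
  - by move=> Au; exists u => //; exact: nearW.
  - by move=> [f0 Af0 sf0]; exact: (svalP A) sf0 Af0.
  - move=> Au.
    pose f0 n : mor C (Xs n) Y1 := xget 0 [set g | u n = s \oc g].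
    have sf0 : \forall n \near \oo, s \oc f0 n = u n.
      apply: filterS (W_bij sW) => n [_ surj]; have [g ug] := surj (u n).
      have /= := xgetI 0 (P := [set g | u n = s \oc g]) ug.
      by [].
    exists f0 => //; apply: (svalP A) Au.
    by apply: filterS sf0 => n ->.
have F0 : pull f = pull 0 by rewrite -[LHS]GQ -[RHS]GQ Qf0 linear0.
have A_sat (g g' : forall n, mor C (Xs n) Z) :
    (\forall n \near \oo, g n = g' n) ->
    (\forall n \near \oo, g n = 0) -> (\forall n \near \oo, g' n = 0).
  by apply: filterS2 => n ->.
pose A : germset Z := exist _ [set g | \forall n \near \oo, g n = 0] A_sat.
suff : sval (pull f A) T by [].
by rewrite F0 /=; apply: nearW => n; exact: comp0l.
Qed.

End Localisation.

(** * Exact sequences in triangulated categories *)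

Section Triangulated.
Set Implicit Arguments.
Unset Strict Implicit.
Variables (k : fieldType) (C : tricat k).
Implicit Types T U V X Y Z W : tob C.

Lemma shm_inj X Y : injective (shm (t := C) X Y).
Proof. exact: bij_inj (sh_ff X Y). Qed.

Lemma shm_surj X Y (g : mor C (susp X) (susp Y)) : exists f, g = shm X Y f.
Proof. by have [f _ fK] := sh_ff X Y; exists (f g); rewrite fK. Qed.

Lemma susp_zeroP X : is_zero C (susp X) <-> is_zero C X.
Proof.
split; last by move=> X0; rewrite /is_zero -shm1 X0 linear0.
by move=> sX0; apply: (@shm_inj X X); rewrite shm1 sX0 linear0.
Qed.

Lemma susp_dsum (I : finType) (F : I -> tob C) X :
  is_dsum C F X -> is_dsum C (fun i => susp (F i)) (susp X).
Proof.
move=> [inj [pr [pi pij s1]]].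
exists (fun i => shm _ _ (inj i)), (fun i => shm _ _ (pr i)); split.
- by move=> i; rewrite -shmM pi shm1.
- by move=> i j ij; rewrite -shmM pij // linear0.
- by rewrite -shm1 -s1 linear_sum; apply: eq_bigr => i _; rewrite shmM.
Qed.

Lemma indec_unsusp X : indec C (susp X) -> indec C X.
Proof.
move=> [sX0 indX]; split; first by move/susp_zeroP.
move=> A B /susp_dsum sAB.
have : is_dsum2 C (susp A) (susp B) (susp X).
  by move: sAB; congr (is_dsum C _ _); apply/funext => -[].
by move=> /indX[] /susp_zeroP; [left|right].
Qed.

Lemma exists_zero : exists Z, is_zero C Z.
Proof.
have F : 'I_0 -> tob C by case.
have [Z [inj [pr [_ _ s1]]]] := tadd F.
by exists Z; rewrite /is_zero -s1 big_ord0.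
Qed.

(** Complete (u, 0) to a morphism from the rotation of the triangle of
    [idh T] to the rotation of the given one; full faithfulness of the
    suspension brings its third component back to degree 0. *)
Lemma dist_exact T X Y Z (f : mor C X Y) (g : mor C Y Z)
    (h : mor C Z (susp X)) (u : mor C T Y) :
  dist f g h -> g \oc u = 0 -> exists v, u = f \oc v.
Proof.
move=> fgh gu; have [O O0] := exists_zero.
have idT := proj1 (dist_rot _ _ _) (dist_id T O0).
have [|c [_ cP]] := dist_mor (a := u) (b := (0 : mor C O Z)) idT
                      (proj1 (dist_rot _ _ _) fgh).
  by rewrite gu comp0r.
have [v vc] := shm_surj c; exists v; apply: shm_inj.
rewrite shmM -vc; apply: oppr_inj.
by rewrite -compNl -cP compNr shm1 comp1r.
Qed.

(** The dual argument, with the triangle 0 -> T -> T -> 0. *)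
Lemma dist_coexact T X Y Z (f : mor C X Y) (g : mor C Y Z)
    (h : mor C Z (susp X)) (u : mor C Y T) :
  dist f g h -> u \oc f = 0 -> exists v, u = v \oc g.
Proof.
move=> fgh uf; have [O O0] := exists_zero.
have idT : dist (0 : mor C O T) (idh T) (0 : mor C T (susp O)).
  apply/dist_rot; rewrite linear0 oppr0; apply: dist_id.
  exact/susp_zeroP.
have [|c [cP _]] := dist_mor (a := (0 : mor C X O)) (b := u) fgh idT.
  by rewrite uf comp0r.
by exists c; rewrite cP comp1l.
Qed.

Lemma cone_bij T X Y Z (f : mor C X Y) (g : mor C Y Z) (h : mor C Z (susp X)) :
  dist f g h -> (forall u : mor C T Z, u = 0) ->
  (forall u : mor C (susp T) Z, u = 0) ->
  (forall u v : mor C T X, f \oc u = f \oc v -> u = v) /\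
  (forall u : mor C T Y, exists v, u = f \oc v).
Proof.
move=> fgh TZ sTZ; split; last first.
  by move=> u; apply: (dist_exact fgh); exact: TZ.
move=> u v fuv; apply/eqP; rewrite -subr_eq0; apply/eqP.
have fghr := proj1 (dist_rot _ _ _) (proj1 (dist_rot _ _ _) fgh).
have [|w] := dist_exact fghr (u := shm _ _ (u - v)).
  by rewrite compNl -shmM compDr compNr fuv subrr linear0 oppr0.
by rewrite (sTZ w) comp0r => uv; apply: shm_inj; rewrite uv linear0.
Qed.

End Triangulated.

(** * The cyclic order on marked points *)

Section CyclicOrder.
Set Implicit Arguments.
Unset Strict Implicit.
Variable R : realType.
Implicit Types p q r : R * R.

Lemma ccw_rot p q r : ccw p q r -> ccw q r p.
Proof. by rewrite /ccw; lra. Qed.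

Lemma ccw_neq p q r : ccw p q r -> [/\ p <> q, q <> r & p <> r].
Proof. by rewrite /ccw; split=> e; move: H; rewrite e; lra. Qed.

Lemma ccw_asym p q r : ccw p q r -> ~ ccw r q p.
Proof. by rewrite /ccw; lra. Qed.

End CyclicOrder.

Lemma set2_eq (T : Type) (a b c d : T) :
  [set a; b] = [set c; d] -> (a = c /\ b = d) \/ (a = d /\ b = c).
Proof.
move=> /seteqP[s1 s2].
have [] : [set c; d] a by apply: s1; left.
all: have [] : [set c; d] b by apply: s1; right.
all: have [] : [set a; b] c by apply: s2; left.
all: have [] : [set a; b] d by apply: s2; right.
all: move=> /= *; subst; by [left|right].
Qed.

Lemma image_set2 (T U : Type) (f : T -> U) (a b : T) :
  f @` [set a; b] = [set f a; f b].
Proof. by rewrite image_setU !image_set1. Qed.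

Section MarkedPoints.
Set Implicit Arguments.
Unset Strict Implicit.
Variables (R : realType) (M : set (R * R)).
Local Notation contract := Defs.contract.
Hypothesis M_acc : forall p, M p -> ~ acc M p.
Implicit Types (a b c d : marked M) (z : acc M).

(** The index of a point inside its added interval; the value 0 at old points
    is a dummy. *)
Definition pos a : int := if a is New _ i then i else 0.

(** An old end stays where it is: only moves inside an added interval leave the
    object unchanged in the quotient. *)
Definition turn_cw (n : nat) a : marked M :=
  match a with Old m => Old m | New z i => New z (i - n%:Z) end.

Lemma contract_turn_cw n a : contract (turn_cw n a) = contract a.
Proof. by case: a. Qed.

Lemma accP z : acc M (val z).
Proof. by have := valP z; rewrite inE. Qed.

Lemma oldP (m : M) : M (val m).
Proof. by have := valP m; rewrite inE. Qed.

Lemma acc_contract a : acc M (contract a) -> exists z i, a = New z i.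
Proof.
case: a => [m|z i] /=; last by exists z, i.
by have := M_acc (oldP m).
Qed.

Lemma before_New z i j : (i < j)%R -> before (New z i) (New z j).
Proof. by exists z, i, j. Qed.

Lemma before_contract a b : before a b -> contract a = contract b.
Proof. by move=> [z [i [j [-> ->]]]]. Qed.

Lemma before_acc a b : before a b -> acc M (contract a).
Proof. by move=> [z [i [j [-> _ _]]]]; apply: accP. Qed.

Lemma before_pos a b : before a b -> (pos a < pos b)%R.
Proof. by move=> [z [i [j [-> -> ij]]]]. Qed.

Lemma same_contract a b : contract a = contract b -> a <> b ->
  exists z, a = New z (pos a) /\ b = New z (pos b).
Proof.
case: a b => [m|z i] [m'|z' j] /=.
- by move=> /val_inj ->.
- move=> mz; case: (M_acc (oldP m)).
  by rewrite (_ : val m = val z') //; exact: accP.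
- move=> zm; case: (M_acc (oldP m')).
  by rewrite (_ : val m' = val z) //; exact: accP.
- by move=> /val_inj -> _; exists z'.
Qed.

(** With the outer points in different places, c either is in a third place or
    shares an interval with exactly one of them. *)
Lemma mccwE a b c : contract a <> contract b ->
  mccw a c b <-> [\/ ccw (contract a) (contract c) (contract b),
                     before a c | before c b].
Proof.
move=> ab; split.
  move=> [h|h|h].
  - by constructor 1.
  - case: h => [[h _]|[[h _]|[h _]]]; [by constructor 2|by constructor 3|].
    by case: ab; rewrite (before_contract h).
  - case: h => [[h _]|[[h _]|[h _]]]; first by constructor 2.
      by constructor 3.
    by case: ab; rewrite (before_contract h).
move=> [h|h|h]; first by constructor 1.
  by constructor 2; left; split=> // ba; apply: ab.
by constructor 2; right; left; split=> // /[!(before_contract h)].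
Qed.

Lemma next_cw_New z i : next_cw (New z i) (New z (i - 1) : marked M).
Proof.
split=> [[]|c]; first by lia.
move=> [/ccw_neq[_ _]|h|h] //.
  case: h => [[_ []]|[[/before_contract h []]|[/before_pos /= h _]]] //.
  by move: h; lia.
have bp a b := @before_pos a b.
by case: h => [|[]] => -[] /bp /= + /bp /=; lia.
Qed.

Lemma not_next_cw_New a z i : contract a <> val z ->
  ~ next_cw a (New z i).
Proof.
move=> az [_ /(_ (New z (i + 1)))]; apply; constructor 2; left.
by split=> //; apply: before_New; lia.
Qed.

Lemma not_next_New_cw a z i : contract a <> val z ->
  ~ next_cw (New z i) a.
Proof.
move=> az [_ /(_ (New z (i - 1)))]; apply; constructor 2; right; left.
by split=> //; apply: before_New; lia.
Qed.

(** An old point has no clockwise neighbour among the new ones, since each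
    added interval is unbounded counter-clockwise. *)
Lemma sigma_New a z i : sigma a = New z i -> exists j, a = New z j.
Proof.
rewrite /sigma; case: xgetP => [b _ /= ab bz|_ ->]; last by exists i.
have az : contract a = contract (New z i : marked M).
  apply: contrapT => ne; rewrite bz in ab.
  exact: (not_next_cw_New ne ab).
have [->|ne] := pselect (a = New z i); first by exists i.
by have [z' [-> [->]]] := same_contract az ne; eexists.
Qed.

Lemma is_arc_turn_cw a b n p : contract a <> contract b -> is_arc [set a; b] ->
  is_arc [set turn_cw n a; turn_cw p b].
Proof.
move=> ab arc_ab.
case: a b ab arc_ab => [m|z i] [m'|z' j] //= ab _.
- exists (Old m), (New z' (j - p%:Z)); split=> // -[].
    exact: not_next_cw_New.
  exact: not_next_New_cw.
- exists (New z (i - n%:Z)), (Old m'); split=> // -[].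
    by apply: not_next_New_cw => /esym.
  by apply: not_next_cw_New => /esym.
- exists (New z (i - n%:Z)), (New z' (j - p%:Z)); split.
  + by [].
  + by case => e; case: ab; rewrite e.
  + by move=> []; [apply: not_next_cw_New|apply: not_next_cw_New => /esym].
Qed.

Lemma is_arc_New z i j : (i + 1 < j)%R ->
  is_arc [set New z i; New z j : marked M].
Proof.
move=> ij; exists (New z i), (New z j); split=> //; first by case; lia.
move=> [] [_].
  move/(_ (New z (j + 1))); apply; constructor 3; right; right.
  by split; apply: before_New; lia.
move/(_ (New z (i + 1))); apply; constructor 3; left.
by split; apply: before_New; lia.
Qed.

(** The position that s reaches relative to t after a long enough clockwise
    rotation ([far_turn_cw]). *)
Definition far (s t : set (marked M)) : Prop := forall x y, s x -> t y ->
  acc M (contract x) -> contract x = contract y -> (pos x < pos y)%R.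

Lemma mccw_far a b c : contract a <> contract b -> far [set a; b] [set c] ->
  (mccw a c b <-> ccw (contract a) (contract c) (contract b) \/
     acc M (contract a) /\ contract a = contract c).
Proof.
move=> ab ft; rewrite mccwE //; split.
  move=> [h|h|h]; first by left.
    by right; split; [exact: before_acc h|exact: before_contract].
  have := before_pos h; have := ft b c (or_intror erefl) erefl.
  rewrite -(before_contract h) => /(_ (before_acc h) erefl); lia.
move=> [h|[aa ac]]; first by constructor 1.
constructor 2.
have := ft a c (or_introl erefl) erefl aa ac.
have [z [i ea]] := acc_contract aa; move: aa; rewrite ac.
move=> /acc_contract[z' [j ec]]; move: ac; rewrite ea ec /= => /val_inj -> ij.
exact: before_New.
Qed.

Lemma cross_far a b c d : contract a <> contract b ->
  far [set a; b] [set c; d] ->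
  (mccw a c b /\ mccw b d a <->
   (ccw (contract a) (contract c) (contract b) \/
     acc M (contract a) /\ contract a = contract c) /\
   (ccw (contract b) (contract d) (contract a) \/
     acc M (contract b) /\ contract b = contract d)).
Proof.
move=> ab ft; rewrite mccw_far //; last first.
  by move=> x y xab /= ->; apply: ft => //; left.
rewrite mccw_far //; first exact: nesym.
by move=> x y xab /= ->; apply: ft; [rewrite setUC|right].
Qed.

(** A common accumulation point realises an alternation by itself, as s is
    placed before t there.  So two arcs that share one such point cross iff the
    remaining alternation holds, and two arcs that share two of them cross. *)
Lemma crossing_far a b c d : contract a <> contract b ->
  contract c <> contract d -> far [set a; b] [set c; d] ->
  let s := [set contract a; contract b] in
  let t := [set contract c; contract d] in
  crossing (@mccw R M) [set a; b] [set c; d] <->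
  [\/ crossing (@ccw R) s t,
      s <> t /\ (exists z m n : R * R, [/\ s `&` t `&` acc M = [set z],
                   s = [set z; m], t = [set z; n] & ccw z m n])
    | s = t /\ s `<=` acc M].
Proof.
move=> ab cd ft s t.
have crossI p q r u : [set a; b] = [set p; q] -> [set c; d] = [set r; u] ->
    (ccw (contract p) (contract r) (contract q) \/
     acc M (contract p) /\ contract p = contract r) ->
    (ccw (contract q) (contract u) (contract p) \/
     acc M (contract q) /\ contract q = contract u) ->
    crossing (@mccw R M) [set a; b] [set c; d].
  move=> spq tru h1 h2; exists p, q, r, u.
  suff [] : mccw p r q /\ mccw q u p by [].
  apply/cross_far => //; last by rewrite -spq -tru.
  by case: (set2_eq spq) => -[<- <-] //; exact: nesym.
have ba : [set a; b] = [set b; a] by rewrite setUC.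
have dc : [set c; d] = [set d; c] by rewrite setUC.
split.
  move=> [a' [b' [c' [d' [sab tcd m1 m2]]]]].
  have es : s = [set contract a'; contract b'].
    by rewrite /s -!image_set2 sab.
  have et : t = [set contract c'; contract d'].
    by rewrite /t -!image_set2 tcd.
  have ab' : contract a' <> contract b'.
    by case: (set2_eq sab) => -[<- <-] //; exact: nesym.
  have ft' : far [set a'; b'] [set c'; d'] by rewrite -sab -tcd.
  rewrite es et; move: {sab tcd ft} ab' ft' (conj m1 m2) => {}ab' ft'.
  move=> m12; have := proj1 (cross_far ab' ft') m12.
  move=> [[h1|[az e1]] [h2|[bw e2]]].
  - constructor 1.
    by exists (contract a'), (contract b'), (contract c'), (contract d').
  - have [n1 n2 n3] := ccw_neq h1.
    constructor 2; split.
      by move=> e; case: (set2_eq e) => -[? ?]; congruence.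
    exists (contract b'), (contract a'), (contract c'); split.
    + apply/seteqP; split => [x [[]] /= [->|->] [e|e] //|x ->]; try congruence.
      by split=> //; split; right.
    + by rewrite setUC.
    + by rewrite setUC e2.
    + by do 2!apply: ccw_rot.
  - have [n1 n2 n3] := ccw_neq h2.
    constructor 2; split.
      by move=> e; case: (set2_eq e) => -[? ?]; congruence.
    exists (contract a'), (contract b'), (contract d'); split.
    + apply/seteqP; split => [x [[]] /= [->|->] [e|e] //|x ->]; try congruence.
      by split=> //; split; left.
    + by [].
    + by rewrite e1.
    + by do 2!apply: ccw_rot.
  - constructor 3; rewrite -e1 -e2; split=> // x [] -> //.
move=> [].
- move=> [p [q [r [u [spq tru c1 c2]]]]].
  case: (set2_eq spq) (set2_eq tru) => -[? ?] [] [? ?]; subst p q r u.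
  + by apply: (crossI a b c d) => //; left.
  + by apply: (crossI a b d c) => //; left.
  + by apply: (crossI b a c d) => //; left.
  + by apply: (crossI b a d c) => //; left.
- move=> [_ [z [m [n [sz sm tn zmn]]]]].
  have zacc : acc M z by have [] : (s `&` t `&` acc M) z by rewrite sz.
  have mnz := ccw_rot zmn.
  case: (set2_eq sm) (set2_eq tn) => -[az bm] [] [cz dn].
  + apply: (crossI a b c d) => //; [right|left].
      by rewrite az cz.
    by rewrite bm dn az.
  + apply: (crossI a b d c) => //; [right|left].
      by rewrite az dn.
    by rewrite bm cz az.
  + apply: (crossI b a c d) => //; [right|left].
      by rewrite bm cz.
    by rewrite az dn bm.
  + apply: (crossI b a d c) => //; [right|left].
      by rewrite bm dn.
    by rewrite az cz bm.
- move=> [st sacc].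
  have aacc : acc M (contract a) by apply: sacc; left.
  have bacc : acc M (contract b) by apply: sacc; right.
  case: (set2_eq st) => -[ac bd].
    by apply: (crossI a b c d) => //; right.
  by apply: (crossI a b d c) => //; right.
Qed.

(** If no end of {a, b} is at z, both alternations would put z on the two sides
    of this chord; if one is, it precedes both ends of the other arc. *)
Lemma crossing_interval a b z i j : contract a <> contract b ->
  far [set a; b] [set New z i; New z j] ->
  ~ crossing (@mccw R M) [set a; b] [set New z i; New z j].
Proof.
move=> ab ft [a' [b' [c [d [sab tcd m1 m2]]]]].
have ab' : contract a' <> contract b'.
  by case: (set2_eq sab) => -[<- <-] //; exact: nesym.
have ft' : far [set a'; b'] [set c; d] by rewrite -sab -tcd.
have [cz dz] : contract c = val z /\ contract d = val z.
  by case: (set2_eq tcd) => -[<- <-].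
have := proj1 (cross_far ab' ft') (conj m1 m2); rewrite cz dz.
move=> [[h1|[_ e1]] [h2|[_ e2]]].
- exact: ccw_asym h1 h2.
- by have [_] := ccw_neq h1; rewrite e2.
- by have [_] := ccw_neq h2; rewrite e1.
- by case: ab'; rewrite e1.
Qed.

End MarkedPoints.

(** * Morphisms of the quotient of the cluster category *)

Section ClusterLocalisation.
Set Implicit Arguments.
Unset Strict Implicit.
Variables (R : realType) (M : set (R * R)).
Local Notation contract := Defs.contract.
Hypothesis M_acc : forall p, M p -> ~ acc M p.
Variables (k : fieldType) (C : tricat k) (ell : tob C -> set (marked M)).
Hypothesis hC : cluster_category ell.
Variables (Cbar : lincat k (tob C)).
Variable Q : forall X Y, {linear mor C X Y -> mor Cbar X Y}.
Hypothesis hQ : localisation (@Sigma R M k C ell) Q.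
Implicit Types (X Y Z U V : tob C) (a b c d e : marked M).

Lemma inD_interval X : indec C X -> in_interval ell X -> inD ell X.
Proof. by move=> iX zX; exists 1%N, (fun=> X); split=> //; exact: is_dsum1. Qed.

Lemma not_inD_arc X : indec C X -> ~ inD ell X ->
  exists a b, ell X = [set a; b] /\ contract a <> contract b.
Proof.
move=> iX nX; have [a [b [lX ab _]]] := cl_arc hC iX.
exists a, b; split=> // cab; apply/nX/(inD_interval iX).
have [z [ea eb]] := same_contract M_acc cab ab.
by exists z; rewrite lX => x [] ->; [exists (pos a)|exists (pos b)].
Qed.

Lemma interval_arc X : indec C X -> in_interval ell X ->
  exists z i j, ell X = [set New z i; New z j].
Proof.
move=> iX [z zX]; have [a [b [lX _ _]]] := cl_arc hC iX.
have [i _ ei] : range (New z) a by apply: zX; rewrite lX; left.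
have [j _ ej] : range (New z) b by apply: zX; rewrite lX; right.
by exists z, i, j; rewrite lX ei ej.
Qed.

(** The suspension moves arcs one step clockwise, so a desuspension of U has its
    ends in the interval of U. *)
Lemma interval_unsusp U : indec C U -> in_interval ell U ->
  exists V, [/\ indec C V, in_interval ell V & isomorphic C (susp V) U].
Proof.
move=> iU [z zU]; have [V VU] := sh_es U.
have isV : indec C (susp V) by apply: indec_iso iU; exact: isomorphic_sym.
have iV := indec_unsusp isV.
exists V; split=> //; exists z => x lx.
have [j _ /esym ej] : range (New z) (sigma x).
  apply: zU; rewrite -(proj2 (cl_inj hC isV iU) VU) (cl_sh hC iV).
  by exists x.
by have [i ->] := sigma_New M_acc ej; exists i.
Qed.

Lemma represents_ex a b : a <> b -> exists A, represents ell A a b.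
Proof.
move=> ab; have [nab|nab] := pselect (neighbours a b).
  by have [A A0] := exists_zero C; exists A; right.
have [|A [iA lA]] := cl_surj hC (s := [set a; b]); first by exists a, b.
by exists A; left.
Qed.

Lemma cluster_hom0 X Y (u : mor C X (susp Y)) : indec C X -> indec C Y ->
  ~ crossing (@mccw R M) (ell X) (ell Y) -> u = 0.
Proof. by move=> iX iY /(cl_ncross hC iX iY)/has_dim0P. Qed.

Lemma mccw_same_contract a b c : contract a = contract b -> ~ before c b ->
  mccw a c b -> before b a.
Proof.
move=> ab ncb [/ccw_neq[]//|[[_ []]|[[]|[]]]//|[[]|[[]|[]]]//]; by rewrite ab.
Qed.

(** The points of t lie outside the interval or after both ends of the arc, so
    they are all on the same side of it. *)
Lemma interval_crossing z i j (t : set (marked M)) :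
  far [set New z i; New z j] t ->
  ~ crossing (@mccw R M) [set New z i; New z j] t.
Proof.
move=> ft [a [b [c [d [sab tcd m1 m2]]]]].
have cab : contract a = contract b.
  by case: (set2_eq sab) => -[<- <-].
have nb x y : [set New z i; New z j] x -> t y -> ~ before y x.
  move=> sx ty h; have := ft _ _ sx ty; rewrite -(before_contract h).
  by move=> /(_ (before_acc h) erefl); have := before_pos h; lia.
have h1 : before b a.
  apply: (mccw_same_contract cab) m1.
  by apply: nb; [rewrite sab; right|rewrite tcd; left].
have h2 : before a b.
  apply: (mccw_same_contract (esym cab)) m2.
  by apply: nb; [rewrite sab; left|rewrite tcd; right].
by have := before_pos h1; have := before_pos h2; lia.
Qed.

(** This is the exchange triangle of X' and the arc W that joins a to the point
    just before its new position.  One middle term is a boundary segment and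
    vanishes, the other one is X.  The last assertion holds because W does not
    cross an arc Y all of whose ends in the interval come after a. *)
Lemma rotate_end X X' a b n : contract a <> contract b ->
  indec C X -> ell X = [set a; b] ->
  indec C X' -> ell X' = [set turn_cw n a; b] ->
  exists t : mor C X' X, isoh (Q X' X t) /\
    forall Y, indec C Y -> far [set a] (ell Y) ->
      forall u : mor C X (susp Y), u \oc t = 0 -> u = 0.
Proof.
move=> ab iX lX iX' lX'.
have [e|ne] := pselect (turn_cw n a = a).
  have [t tiso] : isomorphic C X' X.
    by apply/(cl_inj hC iX' iX); rewrite lX' lX e.
  exists t; split; first exact: (Q_isoh hQ).
  by move=> Y _ _ u ut; apply: (isoh_inj_pre tiso); rewrite ut comp0l.
(* An old end does not move, so a is a new point and n is positive. *)
case: a ab lX lX' ne => [m|z i] // ab lX lX' ne.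
have n0 : (0 < n)%N by case: (n) ne => // -[]; rewrite /= subr0.
pose a2 : marked M := New z (i - n%:Z - 1).
pose a3 : marked M := New z (i - n%:Z).
pose a4 : marked M := New z i.
have ba2 : b <> a2 by move=> e; apply: ab; rewrite e.
have a34 : a3 <> a4 by move=> [e]; lia.
have arcW : is_arc [set a2; a4] by apply: is_arc_New; lia.
have [W [iW lW]] := cl_surj hC arcW.
have [A12 rA12] := represents_ex ba2.
have [A34 rA34] := represents_ex a34.
have [O O0] := exists_zero C.
have rA23 : represents ell O a2 a3.
  by right; split=> //; right; exact: next_cw_New.
have rA41 : represents ell X a4 b by left.
have b23 : before a2 a3 by apply: before_New; lia.
have b34 : before a3 a4 by apply: before_New; lia.
have m1 : mccw b a2 a3.
  by constructor 2; right; left; split=> //; exact: nesym.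
have m2 : mccw b a3 a4.
  by constructor 2; right; left; split=> //; exact: nesym.
have lX'2 : ell X' = [set b; a3] by rewrite setUC.
have [[S [f [g [h [sS fgh _]]]]] _] :=
  cl_exch hC m1 m2 iX' lX'2 iW lW rA12 rA23 rA34 rA41.
have [p piso] := dsum2_zerol sS O0.
have [q [/= qp pq]] := piso.
have tri : dist (p \oc f) (g \oc q) h.
  refine (dist_iso (isoh_id C X') piso (isoh_id C W) _ _ _ fgh).
  - by rewrite comp1r.
  - by rewrite -Defs.compA qp comp1l comp1r.
  - by rewrite shm1 comp1l comp1r.
have zW : in_interval ell W by exists z; rewrite lW => x [] ->; eexists.
exists (p \oc f); split.
  by apply: (locW hQ); exists W, (g \oc q), h; split=> //; exact: inD_interval.
move=> Y iY ft u ut; have [v ->] := dist_coexact tri ut.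
rewrite (cluster_hom0 v iW iY) ?comp0l // lW; apply: interval_crossing.
move=> x y [] -> ty acx e.
  by have := ft a4 y erefl ty acx e; rewrite /=; lia.
exact: ft.
Qed.

(** Rotate the two ends one after the other. *)
Lemma rotate_ends X X' a b n : contract a <> contract b ->
  indec C X -> ell X = [set a; b] ->
  indec C X' -> ell X' = [set turn_cw n a; turn_cw n b] ->
  exists t : mor C X' X, isoh (Q X' X t) /\
    forall Y, indec C Y -> far [set a; b] (ell Y) ->
      forall u : mor C X (susp Y), u \oc t = 0 -> u = 0.
Proof.
move=> ab iX lX iX' lX'.
have arcX : is_arc [set a; b] by rewrite -lX; exact: (cl_arc hC iX).
have turn0 c : turn_cw 0 c = c by case: c => // z i; rewrite /= subr0.
have arc1 : is_arc [set turn_cw n a; b].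
  by rewrite -[in X in is_arc X](turn0 b); exact: (is_arc_turn_cw _ _ ab arcX).
have [X1 [iX1 lX1]] := cl_surj hC arc1.
have [t1 [t1iso t1inj]] := rotate_end ab iX lX iX1 lX1.
have [|||t2 [t2iso t2inj]] := @rotate_end X1 X' b (turn_cw n a) n _ iX1 _ iX' _.
- by rewrite contract_turn_cw; exact: nesym.
- by rewrite setUC.
- by rewrite setUC.
exists (t1 \oc t2); split; first by rewrite (locM hQ); exact: isoh_comp.
move=> Y iY ft u; rewrite Defs.compA => ut.
apply: (t1inj Y) => //; first by move=> x y -> ty; apply: ft => //; left.
by apply: (t2inj Y) => // x y -> ty; apply: ft => //; right.
Qed.

Lemma far_turn_cw a b c d :
  \forall n \near \oo, far [set turn_cw n a; turn_cw n b] [set c; d].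
Proof.
exists (absz (pos a) + absz (pos b) + absz (pos c) + absz (pos d) + 1)%N => //.
move=> n /= nN.
have posP e : acc M (contract (turn_cw n e)) -> pos (turn_cw n e) = pos e - n%:Z.
  by rewrite contract_turn_cw => /(acc_contract M_acc)[z [i ->]].
by move=> x y [] -> [] -> /posP -> _; lia.
Qed.

Lemma far_turn_cwl a b n (t : set (marked M)) :
  far [set a; b] t -> far [set turn_cw n a; turn_cw n b] t.
Proof.
have posP e : (pos (turn_cw n e) <= pos e)%R by case: e => [m|z i] //=; lia.
move=> ft x y [] -> ty; rewrite contract_turn_cw => ex exy.
  by apply: le_lt_trans (posP a) _; apply: ft => //; left.
by apply: le_lt_trans (posP b) _; apply: ft => //; right.
Qed.

Section Tower.
Variables (a b : marked M) (Xs : nat -> tob C).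
Hypotheses (ab : contract a <> contract b) (iXs : forall n, indec C (Xs n))
  (lXs : forall n, ell (Xs n) = [set turn_cw n a; turn_cw n b]).

Lemma tower_interval U : indec C U -> in_interval ell U ->
  \forall n \near \oo, forall u : mor C (Xs n) U, u = 0.
Proof.
move=> iU zU; have [V [iV zV [s siso]]] := interval_unsusp iU zU.
have [s' [/= s's ss']] := siso.
have [z [i [j lV]]] := interval_arc iV zV.
apply: filterS (far_turn_cw a b (New z i) (New z j)) => n ft u.
rewrite -(comp1l u) -ss' -Defs.compA (cluster_hom0 (s' \oc u) (iXs n) iV) ?comp0r
  //.
rewrite lXs lV; apply: crossing_interval => //.
by rewrite !contract_turn_cw.
Qed.

Lemma tower_interval_susp U : indec C U -> in_interval ell U ->
  \forall n \near \oo, forall u : mor C (susp (Xs n)) U, u = 0.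
Proof.
move=> iU zU; have [V [iV zV [s siso]]] := interval_unsusp iU zU.
have [s' [/= s's ss']] := siso.
apply: filterS (tower_interval iV zV) => n V0 u.
have [w e] := shm_surj (s' \oc u).
by rewrite -(comp1l u) -ss' -Defs.compA e (V0 w) linear0 comp0r.
Qed.

(** The cone of s is a sum of finitely many arcs to which neither Xs n nor its
    suspension maps once n is large. *)
Lemma tower_W_bij Y Z (s : mor C Y Z) : Sigma ell s -> \forall n \near \oo,
  (forall f g : mor C (Xs n) Y, s \oc f = s \oc g -> f = g) /\
  (forall f : mor C (Xs n) Z, exists g, f = s \oc g).
Proof.
move=> [D [g [h [sgh [m [F [iF [inj [pr [_ _ s1]]]]]]]]]].
have D0 (T : tob C) : (forall i (u : mor C T (F i)), u = 0) ->
    forall u : mor C T D, u = 0.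
  move=> F0 u; rewrite -(comp1l u) -s1 comp_suml big1 // => i _.
  by rewrite -Defs.compA (F0 i (pr i \oc u)) comp0r.
have n1 : \forall n \near \oo, forall i (u : mor C (Xs n) (F i)), u = 0.
  by apply: filter_forall => i; have [] := iF i; exact: tower_interval.
have n2 : \forall n \near \oo, forall i (u : mor C (susp (Xs n)) (F i)), u = 0.
  by apply: filter_forall => i; have [] := iF i; exact: tower_interval_susp.
apply: filterS (filterI n1 n2) => n [F1 F2].
exact: (cone_bij sgh (D0 _ F1) (D0 _ F2)).
Qed.

End Tower.

(** Every morphism p is represented by some g on some Xs n.  If X and Y cross,
    then so do Xs n and Y, and f \oc T n is a nonzero element of the line
    Hom(Xs n, Y[1]), so that g is one of its multiples and p is a multiple of
    Q f. *)
Lemma hom_far X Y a b c d : indec C X -> indec C Y ->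
  ell X = [set a; b] -> ell Y = [set c; d] ->
  contract a <> contract b -> contract c <> contract d ->
  far [set a; b] [set c; d] ->
  (crossing (@mccw R M) (ell X) (ell Y) -> has_dim 1%N (mor Cbar X (susp Y))) /\
  (~ crossing (@mccw R M) (ell X) (ell Y) -> has_dim 0%N (mor Cbar X (susp Y))).
Proof.
move=> iX iY lX lY ab cd ft.
have arcX : is_arc [set a; b] by rewrite -lX; exact: (cl_arc hC iX).
have [Xs XsP] := choice (fun n => cl_surj hC (is_arc_turn_cw n n ab arcX)).
have iXs n : indec C (Xs n) by have [] := XsP n.
have lXs n : ell (Xs n) = [set turn_cw n a; turn_cw n b] by have [] := XsP n.
have crossE n : crossing (@mccw R M) (ell (Xs n)) (ell Y) <->
                crossing (@mccw R M) (ell X) (ell Y).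
  rewrite lX lY lXs !crossing_far // ?contract_turn_cw //.
  exact: far_turn_cwl.
have [T TP] : exists T : forall n, mor C (Xs n) X, forall n,
    isoh (Q _ _ (T n)) /\
    forall Y, indec C Y -> far [set a; b] (ell Y) ->
      forall u : mor C X (susp Y), u \oc T n = 0 -> u = 0.
  exists (fun n => projT1 (cid (rotate_ends ab iX lX (iXs n) (lXs n)))) => n.
  by case: (cid _).
have lift (p : mor Cbar X (susp Y)) : exists n (g : mor C (Xs n) (susp Y)),
    p \oc Q _ _ (T n) = Q _ _ g.
  have := localisation_lift hQ (tower_W_bij ab iXs lXs) p.
  by move=> /filter_ex[n /(_ (T n))[g pg]]; exists n, g.
split=> XY.
  have /has_dim1P[f f0 _] := cl_cross hC iX iY XY.
  apply/has_dim1P; exists (Q _ _ f).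
    apply/eqP => /(localisation_kernel hQ (tower_W_bij ab iXs lXs) T).
    move=> /filter_ex[n fT]; move/eqP: f0; apply.
    by have [_ /(_ Y iY)] := TP n; rewrite lY; apply.
  move=> p; have [n [g pg]] := lift p.
  have [Tiso Tinj] := TP n.
  have /has_dim1P[e e0 eP] := cl_cross hC (iXs n) iY (proj2 (crossE n) XY).
  have [x xP] := eP (f \oc T n); have [y yP] := eP g.
  have x0 : x != 0.
    apply/eqP => x0; move: xP; rewrite x0 scale0r => /Tinj.
    by rewrite lY => /(_ iY ft) /eqP; rewrite (negPf f0).
  exists (y / x); apply: (isoh_inj_pre Tiso).
  rewrite pg compZl -(locM hQ) xP yP !linearZ /=.
  by rewrite scalerA mulrC divfK.
apply/has_dim0P => p; have [n [g pg]] := lift p.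
have [Tiso _] := TP n; apply: (isoh_inj_pre Tiso).
rewrite pg comp0l (cluster_hom0 g (iXs n) iY) ?linear0 //.
by move/crossE.
Qed.

End ClusterLocalisation.

(** * The dimension of morphisms in the quotient *)

Lemma marked_not_acc (R : realType) (M : set (R * R)) :
  marked_set M -> forall p, M p -> ~ acc M p.
Proof.
move=> [_ _ Mi _ _] p /Mi[_ [V nV VM]] /(_ V nV)[q [/eqP qp Mq Vq]].
by have : (V `&` M) q by []; rewrite VM.
Qed.

Lemma has_dim_precomp (k : fieldType) (ob : Type) (C : lincat k ob) X X' Z
    (s : mor C X' X) (n : nat) :
  isoh s -> has_dim n (mor C X' Z) -> has_dim n (mor C X Z).
Proof.
move=> [t [/= ts st]] [[r rlin [r' rr' r'r]]]; constructor.
exists (fun f => r (f \oc s)) => [a u v|].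
  by rewrite compDl compZl rlin.
exists (fun x => r' x \oc t) => [f|x].
  by rewrite rr' -Defs.compA st comp1r.
by rewrite -Defs.compA ts comp1r r'r.
Qed.

Theorem proposition3p14
  (R : realType) (M : set (R * R)) (hM : marked_set M)
  (k : closedFieldType) (C : tricat k) (ell : tob C -> set (marked M))
  (hC : cluster_category ell)
  (Cbar : lincat k (tob C))
  (Q : forall X Y, {linear mor C X Y -> mor Cbar X Y})
  (hQ : localisation (@Sigma R M k C ell) Q)
  (X Y : tob C) (hX : indec C X) (hY : indec C Y)
  (hXD : ~ inD ell X) (hYD : ~ inD ell Y) :
  (exists2 n : nat, (n <= 1)%N & has_dim n (mor Cbar X (susp Y))) /\
  (has_dim 1%N (mor Cbar X (susp Y)) <->
   [\/ crossing (@ccw R) (ellbar ell X) (ellbar ell Y),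
       ellbar ell X <> ellbar ell Y /\
       (exists z m n : R * R,
         [/\ ellbar ell X `&` ellbar ell Y `&` acc M = [set z],
             ellbar ell X = [set z; m], ellbar ell Y = [set z; n]
           & ccw z m n])
     | ellbar ell X = ellbar ell Y /\ ellbar ell X `<=` acc M]).
Proof.
have M_acc := marked_not_acc hM.
have [a [b [lX ab]]] := not_inD_arc M_acc hC hX hXD.
have [c [d [lY cd]]] := not_inD_arc M_acc hC hY hYD.
(* X is replaced by an isomorphic object X' that precedes Y everywhere. *)
have [N ft] := filter_ex (far_turn_cw M_acc a b c d).
have arcX : is_arc [set a; b] by rewrite -lX; exact: (cl_arc hC hX).
have [X' [iX' lX']] := cl_surj hC (is_arc_turn_cw N N ab arcX).
have [t [tiso _]] := rotate_ends hC hQ ab hX lX iX' lX'.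
have ab' : Defs.contract (turn_cw N a) <> Defs.contract (turn_cw N b).
  by rewrite !contract_turn_cw.
have [dim1 dim0] := hom_far M_acc hC hQ iX' hY lX' lY ab' cd ft.
have {}dim1 h := has_dim_precomp tiso (dim1 h).
have {}dim0 h := has_dim_precomp tiso (dim0 h).
have := crossing_far M_acc ab' cd ft.
rewrite -lX' -lY !contract_turn_cw -!image_set2 -lX -lY /= => <-.
split.
  have [/dim1|/dim0] := pselect (crossing (@mccw R M) (ell X') (ell Y)).
    by exists 1%N.
  by exists 0%N.
split=> [h1|/dim1//]; apply: contrapT => /dim0/has_dim0P h0.
by have /has_dim1P[v] := h1; rewrite (h0 v) eqxx.
Qed.
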